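(* Let $G$ be a totally disconnected locally compact (Hausdorff) group satisfying at least one of the following conditions: (i) $G$ is $\sigma$-compact and is not compact-by-discrete; (ii) $G$ is noncompact and does not contain a noncompact, $\sigma$-compact, compact-by-discrete open subgroup; (iii) $G$ is noncompact and contains a sequence $(U_n)_{n\in\mathbb{N}}$ of neighbourhoods of the identity such that $\bigcap_n U_n$ has empty interior. Then the Boolean algebra $\mathfrak{B}(G)$ of all clopen subsets of $G$ is not left introverted.
   Context: All topological spaces and groups are Hausdorff. A locally compact group is compact-by-discrete if it has a compact open normal subgroup. For a topological group $G$, $\mathfrak{B}(G)$ denotes the Boolean algebra (under union, intersection, complement) of all clopen subsets of $G$. A $\mathfrak{B}(G)$-ultrafilter is an ultrafilter in this Boolean algebra. For a $\mathfrak{B}(G)$-ultrafilter $\mathcal{V}$ and $B\in\mathfrak{B}(G)$, put $\mathcal{V}\cdot B=\{s\in G: s^{-1}B\in\mathcal{V}\}$. The Boolean algebra $\mathfrak{B}(G)$ is called left introverted if $\mathcal{V}\cdot B\in\mathfrak{B}(G)$ (i.e. $\mathcal{V}\cdot B$ is clopen in $G$) for every $\mathfrak{B}(G)$-ultrafilter $\mathcal{V}$ and every $B\in\mathfrak{B}(G)$. *)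

(* Defs.v *)
From HB Require Import structures.
From mathcomp Require Import all_boot.
From mathcomp Require Import boolp classical_sets filter topology.

Set Implicit Arguments.
Unset Strict Implicit.
Unset Printing Implicit Defensive.

Local Open Scope classical_set_scope.
Local Open Scope group_scope.

HB.mixin Record isTopologicalGroup G & Topological G & Group G := {
  mulg_continuous : continuous (fun x : G * G => x.1 * x.2) ;
  invg_continuous : continuous (fun x : G => x^-1)
}.

(* The Hausdorff axiom is not part of the structure: it is stated separately,
   with hausdorff_space. *)
#[short(type="topologicalGroupType")]
HB.structure Definition TopologicalGroup :=
  {G of Topological G & Group G & isTopologicalGroup G}.

Definition subgroup (G : groupType) (H : set G) : Prop :=
  [/\ H 1, forall x y, H x -> H y -> H (x * y) & forall x, H x -> H x^-1].

Definition normal_subgroup (G : groupType) (K H : set G) : Prop :=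
  [/\ subgroup K, K `<=` H & forall h k, H h -> K k -> K (h * k * h^-1)].

Definition sigma_compact (T : topologicalType) (A : set T) : Prop :=
  exists K : nat -> set T, (forall n, compact (K n)) /\ A = \bigcup_n K n.

(* For a subgroup H of G, viewed as a topological group with the topology
   induced by G: openness of K is relative to H, whereas compactness of K does
   not depend on the ambient space. The case of G itself is H = [set: G]. *)
Definition compact_by_discrete (G : topologicalGroupType) (H : set G) : Prop :=
  exists K : set G,
    [/\ normal_subgroup K H, compact K & open (K : set (subspace H))].

(* Filters in an algebra of sets A, ordered by inclusion (in contrast with
   Filter and UltraFilter, whose elements are arbitrary sets). *)
Definition proper_filter_in (T : Type) (A F : set_system T) : Prop :=
  [/\ F `<=` A, F [set: T], ~ F set0,
      forall B C, F B -> F C -> F (B `&` C)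
    & forall B C, F B -> A C -> B `<=` C -> F C].

Definition ultrafilter_in (T : Type) (A F : set_system T) : Prop :=
  proper_filter_in A F /\
  forall F', proper_filter_in A F' -> F `<=` F' -> F' = F.

Definition ultrafilter_act (G : groupType) (V : set_system G) (B : set G) :
  set G := [set s | V [set s^-1 * b | b in B]].

Definition left_introverted (G : groupType) (A : set_system G) : Prop :=
  forall V B, ultrafilter_in A V -> A B -> A (ultrafilter_act V B).

(* Main.v *)
(* All three conditions reduce to (iii). If H is an open sigma-compact subgroup
   that is not compact-by-discrete, and K is a compact open subgroup of H, then
   the intersection of the conjugates of K under H is a compact normal subgroup
   of H, hence has empty interior; by sigma-compactness of H it is a countable
   intersection of neighbourhoods of 1. In case (i) take H = G; in case (ii)
   take H generated by K and infinitely many representatives of cosets of K, so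
   that H is not compact.

   Under (iii), choose a sequence g_n with K g_n pairwise disjoint, and clopen
   neighbourhoods W_n of 1 contained in K and in U_0, ..., U_n. The union B of
   the sets W_n g_n is clopen, and if V is an ultrafilter along g that contains
   all tails of g, then V.B contains 1, while its intersection with K is
   contained in the intersection of the U_n, so that V.B is not open. *)
Require Import Defs.
From mathcomp Require Import all_boot.
From mathcomp Require Import boolp classical_sets filter topology.

Local Open Scope classical_set_scope.
Local Open Scope group_scope.

(** * Compactness and clopen neighbourhoods *)

(** Otherwise the sets [D \ O] generate a proper filter on [K]. A cluster point of it lies in every
    closed [D], hence in [O], but also in the closed complement of [O]. *)
Lemma compact_directed_sub {T : topologicalType} {K O : set T} {S : set_system T} :
  compact K -> open O -> S !=set0 ->
  (forall D E, S D -> S E -> S (D `&` E)) ->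
  (forall D, S D -> closed D /\ D `<=` K) ->
  \bigcap_(D in S) D `<=` O -> exists2 D, S D & D `<=` O.
Proof.
move=> Kc Oo [D0 SD0] SI Scl SO; apply: contrapT => nS.
pose F := filter_from S (fun D => D `\` O).
have FF : ProperFilter F.
  apply: filter_from_proper; last first.
    move=> D SD; apply/set0P/eqP; rewrite setD_eq0 => DO.
    by apply: nS; exists D.
  apply: filter_from_filter; first by exists D0.
  move=> D E SD SE; exists (D `&` E); first exact: SI.
  by move=> x [[Dx Ex] nOx].
have FK : F K by exists D0 => // x [D0x _]; exact: (Scl _ SD0).2.
have [p [_]] := Kc F FF FK; rewrite clusterE => pF.
have : O p.
  apply: SO => D SD; have [Dcl _] := Scl _ SD.
  rewrite [D](iffLR (closure_id D))//; apply: pF.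
  by exists D => // x [].
have : (~` O) p.
  rewrite [~` O](iffLR (closure_id _)); last exact: open_closedC.
  by apply: pF; exists D0 => // x [].
by [].
Qed.

Section clopen_neighbourhoods.
Context {T : topologicalType}.

(** For closed [C], these are the clopen subsets of the subspace [C] that contain [x], described by
    closed sets of [T] only. Their intersection is the quasi-component of [x] in [C]. *)
Definition relatively_clopen (C : set T) (x : T) : set_system T :=
  [set D | [/\ D `<=` C, closed D, closed (C `\` D) & D x]].

Lemma relatively_clopenI C x D E : relatively_clopen C x D ->
  relatively_clopen C x E -> relatively_clopen C x (D `&` E).
Proof.
move=> [DC Dcl CD Dx] [EC Ecl CE Ex]; split=> //.
- by move=> y [/DC].
- exact: closedI.
- by rewrite setDIr; exact: closedU.
Qed.

(** If the quasi-component [Q] splits into two relatively closed pieces, local normality near the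
    compact set [K] separates them, and compactness yields a relatively clopen set that cuts [Q]
    along the same line. *)
Lemma quasi_component_connected {C K : set T} {x : T} :
  hausdorff_space T -> compact K -> closed C -> C `<=` K° -> C x ->
  connected (\bigcap_(D in relatively_clopen C x) D).
Proof.
move=> Th Kc Ccl CK Cx; set Q := \bigcap_(D in _) D.
have CS : relatively_clopen C x C.
  by split=> //; rewrite setDv; exact: closed0.
have QC : Q `<=` C by move=> y /(_ _ CS).
have Qx : Q x by move=> D [].
have Qcl : closed Q by apply: closed_bigI => D [].
have key (O F : set T) : open O -> closed F -> Q `&` O = Q `&` F ->
    O x -> Q `<=` O.
  move=> Oo Fcl QOF Ox.
  have QFK : Q `&` F `<=` K° by move=> y [/QC/CK].
  have [N] : filter_from (set_nbhs (Q `&` F)) closure O.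
    apply: (compact_normal_local Th Kc QFK); first exact: closedI.
    by apply/set_nbhsP; exists O; split=> //; rewrite -QOF => y [].
  move=> /set_nbhsP[P [Po QFP PN]] NO.
  have clPO : closure P `<=` O.
    by apply: subset_trans NO; exact: closureS.
  have QclP : Q `&` closure P `<=` P.
    by move=> y [Qy /clPO Oy]; apply: QFP; rewrite -QOF.
  (* [Q] misses the boundary of [P]. By compactness some relatively clopen [D] misses it too, so [P]
     and its closure have the same trace on [D], and [D] meets [P] in a relatively clopen set. *)
  have [|||||D DS DP] := @compact_directed_sub T K (P `|` ~` closure P)
      (relatively_clopen C x) Kc.
  - by apply: openU => //; apply: closed_openC; exact: closed_closure.
  - by exists C.
  - exact: relatively_clopenI.
  - by move=> D [DC Dcl _ _]; split=> // y /DC/CK/interior_subset.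
  - move=> y Qy; have [Py|nPy] := pselect (closure P y); last by right.
    by left; exact: QclP.
  suff DPS : relatively_clopen C x (D `&` P).
    by move=> y /(_ _ DPS)[_ Py]; apply: clPO; exact: subset_closure.
  have [DC Dcl CD Dx] := DS; split.
  - by move=> y [/DC].
  - suff -> : D `&` P = D `&` closure P.
      by apply: closedI => //; exact: closed_closure.
    apply/seteqP; split=> y [Dy Py]; split=> //; first exact: subset_closure.
    by have [] := DP _ Dy.
  - rewrite setDIr; apply: closedU => //.
    by rewrite setDE; apply: closedI => //; exact: open_closedC.
  - by split=> //; apply: QFP; rewrite -QOF.
move=> B B0 [O Oo BO] [F Fcl BF].
have QOF : Q `&` O = Q `&` F by rewrite -BO.
have [Ox|nOx] := pselect (O x).
  by rewrite BO setIidl//; exact: (key O F).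
(* When [x] lies in the other piece, [key] applies with the complements of [F] and [O]. *)
have QF : Q `<=` ~` F.
  apply: (key (~` F) (~` O)); [exact: closed_openC|exact: open_closedC| |].
    apply/seteqP; split=> y [Qy nOy]; split=> // Oy; apply: nOy.
      by have [] : (Q `&` F) y by rewrite -QOF; split.
    by have [] : (Q `&` O) y by rewrite QOF; split.
  by move=> Fx; have [] : (Q `&` O) x by rewrite QOF; split.
by exfalso; have [y] := B0; rewrite BF => -[/QF].
Qed.

(** Being connected, the quasi-component of [x] in a compact neighbourhood [C] is a single point, so
    by compactness some relatively clopen set fits in the interior of [N]. *)
Lemma totally_disconnected_compact_clopen_nbhs {x : T} {U : set T} :
  hausdorff_space T -> locally_compact [set: T] ->
  totally_disconnected [set: T] -> nbhs x U ->
  exists D, [/\ clopen D, compact D, D x & D `<=` U].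
Proof.
move=> Th Tlc Ttd; rewrite nbhsE => -[V [Vo Vx] VU].
have [K] := Tlc x I; rewrite withinET => Kx [Kc Kcl].
have [N Nx NK] : filter_from (nbhs x) closure (K° `&` V).
  apply: (compact_regular Th Kc) => //.
  apply: filterI; first exact: nbhs_interior.
  exact: open_nbhs_nbhs.
set C := closure N in NK.
have Ccl : closed C by exact: closed_closure.
have CK : C `<=` K° by move=> y /NK[].
have Cx : C x by apply: subset_closure; exact: nbhs_singleton.
have CnK : C `<=` K by move=> y /CK/interior_subset.
have Qco := quasi_component_connected Th Kc Ccl CK Cx.
set Q := \bigcap_(D in _) D in Qco.
have Q1 : Q `<=` [set x].
  rewrite -(Ttd x I); apply: connected_component_max => //.
  by move=> D [].
have [|||||D [DC Dcl CD Dx] DN] := @compact_directed_sub T K N°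
    (relatively_clopen C x) Kc.
- exact: open_interior.
- by exists C; split=> //; rewrite setDv; exact: closed0.
- exact: relatively_clopenI.
- by move=> D [DC Dcl _ _]; split=> // y /DC/CnK.
- by move=> y /Q1 ->.
exists D; split=> //.
(* As [D] lies in the interior of [N], and [N] in [C], relative openness in [C] becomes openness in
   [T]. *)
- split=> //; suff -> : D = N° `&` ~` (C `\` D).
    by apply: openI; [exact: open_interior|exact: closed_openC].
  apply/seteqP; split=> y; first by move=> Dy; split; [exact: DN|case].
  move=> [Ny nCDy]; apply: contrapT => nDy; apply: nCDy; split=> //.
  by apply: subset_closure; exact: interior_subset.
- by apply: (subclosed_compact Dcl Kc) => y /DC/CnK.
- by move=> y /DC/NK[_ /VU].
Qed.

End clopen_neighbourhoods.

(** The tube lemma. Below it turns a condition over all points of a compact set into a neighbourhood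
    of the identity. *)
Lemma compact_tube {X Y : topologicalType} {C : set X} {O : set (X * Y)} {y : Y} :
  compact C -> open O -> (forall x, C x -> O (x, y)) ->
  nbhs y [set y' | forall x, C x -> O (x, y')].
Proof.
move=> /compact_near_coveringP Cc Oo CO.
apply: (Cc Y (nbhs y) (fun y' x => O (x, y'))) => x Cx.
have [[A B] AB ABO] : nbhs (x, y) O.
  by apply: open_nbhs_nbhs; split=> //; exact: CO.
by exists (A, B) => // -[a b] /ABO.
Qed.

(** * Translations and compact open subgroups *)

Section topological_groups.
Context {G : topologicalGroupType}.
Implicit Types (H K N : set G) (g x y : G).

Lemma continuous_mul {T : topologicalType} {f g : T -> G} :
  continuous f -> continuous g -> continuous (fun t => f t * g t).
Proof.
move=> fc gc t.
apply: (@continuous_comp _ _ _ (fun t => (f t, g t)) (fun p : G * G => p.1 * p.2)).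
  by apply: cvg_pair; [exact: fc|exact: gc].
exact: mulg_continuous.
Qed.

Lemma continuous_inv {T : topologicalType} {f : T -> G} :
  continuous f -> continuous (fun t => (f t)^-1).
Proof.
move=> fc t; apply: (@continuous_comp _ _ _ f (fun x : G => x^-1)).
  exact: fc.
exact: invg_continuous.
Qed.

Lemma continuous_mulr y : continuous (fun x : G => x * y).
Proof.
by apply: continuous_mul => x; [exact: cvg_id|exact: cvg_cst].
Qed.

Lemma open_translate {U : set G} y : open U -> open [set x | U (x * y)].
Proof. by move=> Uo; apply: open_comp => // x _; exact: continuous_mulr. Qed.

Lemma nbhs_coset {K} x : open K -> K 1 -> nbhs x [set y | K (y * x^-1)].
Proof.
move=> Ko K1; apply: open_nbhs_nbhs; split; first exact: open_translate.
by rewrite /= mulgV.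
Qed.

(** Right translation by [y^-1 * x], an element of [H], carries [y] to the interior point [x]. *)
Lemma open_subgroup {H x} : subgroup H -> nbhs x H -> open H.
Proof.
move=> [H1 HM HV] xH; rewrite openE => y Hy.
have Hx : H x by exact: nbhs_singleton.
have : nbhs y [set z | H (z * (y^-1 * x))].
  by apply: continuous_mulr; rewrite mulVKg.
apply: filterS => z /= Hz.
rewrite -(mulgK (y^-1 * x) z); apply: (HM) => //; apply: (HV).
by apply: HM => //; exact: HV.
Qed.

(** Van Dantzig's theorem. For a compact clopen [W] containing 1, the set [S] of those [x] with
    [W x] inside [W] is a closed neighbourhood of 1 contained in [W]; the subgroup consists of the
    [x] with both [x] and [x^-1] in [S]. *)
Lemma exists_compact_open_subgroup :
  hausdorff_space G -> locally_compact [set: G] ->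
  totally_disconnected [set: G] ->
  exists K, [/\ subgroup K, open K & compact K].
Proof.
move=> Gh Glc Gtd.
have [W [[Wo Wcl] Wc W1 _]] :=
  totally_disconnected_compact_clopen_nbhs Gh Glc Gtd (@filterT _ (nbhs (1 : G)) _).
pose S := [set x : G | forall w, W w -> W (w * x)].
have S1 : nbhs 1 S.
  apply: (@compact_tube _ _ _ [set p : G * G | W (p.1 * p.2)] 1 Wc).
    by apply: open_comp => // p _; exact: mulg_continuous.
  by move=> w Ww; rewrite /= mulg1.
have SW : S `<=` W by move=> x /(_ _ W1); rewrite mul1g.
have Scl : closed S.
  rewrite (_ : S = \bigcap_(w in W) [set x | W (w * x)]); last first.
    by apply/seteqP; split=> x Sx w; exact: Sx.
  apply: closed_bigI => w _; apply: (closed_comp (f := fun x => w * x)) => // x _.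
  by apply: continuous_mul => z; [exact: cvg_cst|exact: cvg_id].
have invc : continuous (fun x : G => x^-1) by exact: invg_continuous.
pose K := S `&` [set x | S x^-1].
have Ksub : subgroup K.
  split.
  - by split=> [w|w]; rewrite ?invg1 mulg1.
  - move=> x y [Sx Sx'] [Sy Sy']; split=> w Ww.
      by rewrite mulgA; apply: Sy; exact: Sx.
    by rewrite invgM mulgA; apply: Sx'; exact: Sy'.
  - by move=> x [Sx Sx']; split=> //=; rewrite invgK.
exists K; split=> //.
- apply: (@open_subgroup _ 1) => //; apply: filterI => //.
  by apply: invc; rewrite invg1.
- apply: (subclosed_compact _ Wc); last by move=> x [/SW].
  by apply: closedI => //; apply: closed_comp => // x _; exact: invc.
Qed.

(** * Sequences in distinct cosets of a subgroup *)

Lemma separated_sequence {K} : subgroup K -> compact K -> ~ compact [set: G] ->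
  exists g : nat -> G, forall m n, K (g m * (g n)^-1) -> m = n.
Proof.
move=> [K1 KM KV] Kc nGc.
have /choice[h hP] : forall s : seq G, exists y, forall x, x \in s -> ~ K (y * x^-1).
  move=> s; apply: contrapT => ns; apply: nGc.
  suff -> : [set: G] = \big[setU/set0]_(x <- s) [set k * x | k in K].
    apply: bigsetU_compact => x _; apply: continuous_compact => //.
    by apply: continuous_subspaceT; exact: continuous_mulr.
  apply/seteqP; split=> // y _; rewrite -bigcup_seq.
  apply: contrapT => ny; apply: ns; exists y => x xs Kyx; apply: ny.
  by exists x => //; exists (y * x^-1) => //; rewrite mulgVK.
(* [L n] lists the first [n] chosen points, latest first. A next point [h (L n)] outside their
   cosets exists because finitely many compact cosets cannot cover [G]. *)
pose L n := iter n (fun s => h s :: s) [::].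
have gL m n : (m < n)%N -> h (L m) \in L n.
  elim: n => // n IH; rewrite ltnS leq_eqVlt inE => /predU1P[->|/IH ->].
    by rewrite eqxx.
  by rewrite orbT.
exists (fun n => h (L n)) => m n Kmn.
have [mn|nm|//] := ltngtP m n.
- have /(_ _ (gL _ _ mn)) := hP (L n); case.
  by rewrite -invgF; exact: KV.
- by have /(_ _ (gL _ _ nm)) := hP (L m).
Qed.

(** A cluster point [p] of the sequence would have infinitely many terms in its neighbourhood [K p],
    and two of them would share a coset. *)
Lemma compact_no_separated_sequence {K C : set G} {g : nat -> G} :
  subgroup K -> open K -> (forall m n, K (g m * (g n)^-1) -> m = n) ->
  compact C -> ~ (forall n, C (g n)).
Proof.
move=> [K1 KM KV] Ko gK Cc Cg.
have [p [_ pg]] : C `&` cluster (g @ \oo) !=set0.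
  by apply: Cc; exists 0%N => // n _; exact: Cg.
have hit (N : nat) : exists2 n, (N <= n)%N & K (g n * p^-1).
  have [|y [[n Nn <-] Ky]] := pg (g @` [set n | (N <= n)%N]) _ _ (nbhs_coset p Ko K1).
    by exists N => // n Nn; exists n.
  by exists n.
have [m _ Km] := hit 0%N; have [n mn Kn] := hit m.+1.
suff E : m = n by rewrite E ltnn in mn.
by apply: gK; rewrite -(mulgKA p^-1); apply: KM => //; apply: KV.
Qed.

(** * Thin neighbourhoods from sigma-compact subgroups *)

Lemma thin_neighbourhoods {H K} : sigma_compact H -> ~ compact_by_discrete H ->
  subgroup H -> subgroup K -> open K -> compact K -> closed K -> K `<=` H ->
  exists U : nat -> set G,
    (forall n, nbhs (1 : G) (U n)) /\ interior (\bigcap_n U n) = set0.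
Proof.
move=> [C [Cc HC]] nH [H1 HM HV] [K1 KM KV] Ko Kc Kcl KH.
pose conj (g x : G) := g^-1 * x * g.
have conjc : continuous (fun p : G * G => conj p.1 p.2).
  have fc : continuous (fun p : G * G => p.1) by move=> p; exact: cvg_fst.
  have sc : continuous (fun p : G * G => p.2) by move=> p; exact: cvg_snd.
  by do 2![apply: continuous_mul => //]; exact: continuous_inv.
pose N := [set x | forall g, H g -> K (conj g x)].
(* The [n]-th neighbourhood intersects the conjugates of [K] by the compact piece [C n] only, so
   that the tube lemma applies. *)
exists (fun n => [set x | forall g, C n g -> K (conj g x)]); split=> [n|].
  apply: (@compact_tube _ _ _ [set p : G * G | K (conj p.1 p.2)] 1 (Cc n)).
    by apply: open_comp => // p _; exact: conjc.
  by move=> g _; rewrite /= /conj mulg1 mulVg.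
have -> : \bigcap_n [set x | forall g, C n g -> K (conj g x)] = N.
  apply/seteqP; split=> [x Nx g|x Nx n _ g Cg].
    by rewrite HC => -[n _ Cg]; exact: (Nx n).
  by apply: Nx; rewrite HC; exists n.
have NK : N `<=` K by move=> x /(_ _ H1); rewrite /conj invg1 mul1g mulg1.
have Nsub : subgroup N.
  split.
  - by move=> g _; rewrite /conj mulg1 mulVg.
  - move=> x y Nx Ny g Hg.
    rewrite (_ : conj g (x * y) = conj g x * conj g y).
      by apply: KM; [exact: Nx|exact: Ny].
    by rewrite /conj !mulgA mulgK.
  - move=> x Nx g Hg; rewrite (_ : conj g x^-1 = (conj g x)^-1).
      by apply: KV; exact: Nx.
    by rewrite /conj !invgM invgK mulgA.
(* One interior point makes the subgroup [N] open, hence a compact open normal subgroup of [H]. *)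
rewrite -subset0 => x Nx; apply: nH; exists N; split.
- split=> //; first by move=> y /NK/KH.
  move=> h k Hh Nk g Hg.
  rewrite (_ : conj g _ = conj (h^-1 * g) k).
    by apply: Nk; apply: HM => //; exact: HV.
  by rewrite /conj invgM invgK !mulgA.
- apply: (subclosed_compact _ Kc NK).
  rewrite (_ : N = \bigcap_(g in H) [set x | K (conj g x)]); last first.
    by apply/seteqP; split=> y Ny g; exact: Ny.
  apply: closed_bigI => g _; apply: (closed_comp (f := conj g)) => // y _.
  apply: continuous_mul; last by move=> z; exact: cvg_cst.
  by apply: continuous_mul => z; [exact: cvg_cst|exact: cvg_id].
- by apply: open_subspaceW; exact: open_subgroup Nx.
Qed.

Lemma sigma_compact_subgroup_with_sequence {K} {g : nat -> G} :
  subgroup K -> compact K ->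
  exists H, [/\ subgroup H, sigma_compact H, K `<=` H & forall n, H (g n)].
Proof.
move=> [K1 KM KV] Kc.
pose D n A := A `|` [set g n].
(* Each stage adjoins [g n] and forms all quotients [x * y^-1]. Stages stay compact and, as they
   contain 1, increase; their union is closed under quotients. *)
pose C := fix C n := if n is m.+1
  then [set p.1 * p.2^-1 | p in D m (C m) `*` D m (C m)] else K.
have Cc n : compact (C n).
  elim: n => // n IH; have Dc : compact (D n (C n)).
    by apply: compactU => //; exact: compact_set1.
  apply: continuous_compact; last exact: compact_setX.
  apply: continuous_subspaceT.
  have fc : continuous (fun p : G * G => p.1) by move=> p; exact: cvg_fst.
  have sc : continuous (fun p : G * G => p.2) by move=> p; exact: cvg_snd.
  by apply: continuous_mul => //; exact: continuous_inv.
have C1 n : C n 1.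
  elim: n => // n IH; exists (1, 1); last by rewrite /= mulgV.
  by split; left.
have CD n : D n (C n) `<=` C n.+1.
  move=> x Dx; exists (x, 1); last by rewrite /= invg1 mulg1.
  by split=> //; left; exact: C1.
have Cle m n : (m <= n)%N -> C m `<=` C n.
  move=> /subnK <-; elim: (n - m)%N => // k IH x /IH Ckx.
  by rewrite addSn; apply: CD; left.
pose H := \bigcup_n C n.
have HF x y : H x -> H y -> H (x * y^-1).
  move=> [m _ Cx] [n _ Cy]; exists (maxn m n).+1 => //.
  exists (x, y) => //; split; left.
    by apply: Cle Cx; exact: leq_maxl.
  by apply: Cle Cy; exact: leq_maxr.
have H1 : H 1 by exists 0%N.
have HV x : H x -> H x^-1 by move=> Hx; rewrite -[x^-1]mul1g; exact: HF.
exists H; split.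
- by split=> // x y Hx Hy; rewrite -[y]invgK; apply: HF => //; exact: HV.
- by exists C.
- by move=> x Kx; exists 0%N.
- by move=> n; exists n.+1 => //; apply: CD; right.
Qed.

(** * Ultrafilters along a sequence and failure of introversion *)

(** Maximality: if a clopen [A] of a larger filter were not in the image of [F], its clopen
    complement would be, and the two are disjoint. *)
Lemma ultrafilter_in_clopen_along {T : topologicalType} {I : Type} (g : I -> T)
    (F : set_system I) : UltraFilter F ->
  ultrafilter_in (@clopen T) [set A | clopen A /\ F (g @^-1` A)].
Proof.
move=> FU; split=> [|F' [F'cl _ F'0 F'I _] FF'].
  split.
  - by move=> A [].
  - by split; [exact: clopenT|exact: filterT].
  - by case=> _; rewrite preimage_set0; exact: filter_not_empty.
  - move=> A B [Acl FA] [Bcl FB]; split; first exact: clopenI.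
    exact: filterI.
  - by move=> A B [_ FA] Bcl AB; split=> //; apply: filterS FA => i /AB.
apply/seteqP; split=> // A F'A; split; first exact: F'cl.
have [//|FnA] := in_ultra_setVsetC (g @^-1` A) FU.
exfalso; apply: F'0; rewrite -(setICr A); apply: F'I => //; apply: FF'.
by split=> //; apply: clopenC => //; exact: F'cl.
Qed.

Lemma thin_neighbourhoods_not_left_introverted {K} {g : nat -> G}
    {U : nat -> set G} :
  hausdorff_space G -> locally_compact [set: G] ->
  totally_disconnected [set: G] ->
  subgroup K -> open K -> (forall m n, K (g m * (g n)^-1) -> m = n) ->
  (forall n, nbhs (1 : G) (U n)) -> interior (\bigcap_n U n) = set0 ->
  ~ left_introverted (@clopen G).
Proof.
move=> Gh Glc Gtd [K1 KM KV] Ko gK Un U0 Gli.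
have /choice[W WP] n : exists W, [/\ clopen W, W 1, W `<=` K &
    forall i, (i <= n)%N -> W `<=` U i].
  have /(totally_disconnected_compact_clopen_nbhs Gh Glc Gtd)[W [Wcl _ W1 WKU]] :
      nbhs 1 (K `&` [set x | forall i, (i <= n)%N -> U i x]).
    apply: filterI; first exact: open_nbhs_nbhs.
    elim: n => [|n IH].
      by apply: filterS (Un 0%N) => x U0x i; rewrite leqn0 => /eqP->.
    apply: filterS2 IH (Un n.+1) => x Ux Unx i.
    by rewrite leq_eqVlt => /predU1P[->//|]; exact: Ux.
  by exists W; split=> // [x /WKU[]//|i ni x /WKU[_]]; exact.
have WK n x : W n x -> K x by have [_ _ + _] := WP n; exact.
pose B := \bigcup_n [set x | W n (x * (g n)^-1)].
have Bcl : clopen B.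
  split.
    apply: bigcup_open => n _; apply: open_translate.
    by have [[]] := WP n.
  rewrite -[B]setCK; apply: open_closedC; rewrite openE => x nBx.
  have xK := nbhs_coset x Ko K1.
  (* The neighbourhood [K x] meets at most one coset [K g_n], so at most one translate of a [W n]
     has to be avoided near [x]. *)
  have [[n Kxn]|nK] := pselect (exists n, K (x * (g n)^-1)).
    have nW : nbhs x [set y | (~` W n) (y * (g n)^-1)].
      apply: open_nbhs_nbhs; split; last by move=> Wx; apply: nBx; exists n.
      by apply/open_translate/closed_openC; have [[]] := WP n.
    apply: filterS2 xK nW => y Kyx nWy [m _ Wym].
    suff mn : m = n by apply: nWy; rewrite -mn.
    apply: gK; rewrite (_ : _ * _ = (y * (g m)^-1)^-1 * (y * x^-1 * (x * (g n)^-1))).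
      by apply: (KM); [apply: KV; exact: WK Wym|exact: KM].
    by rewrite invgM invgK !mulgA !mulgVK.
  apply: filterS xK => y Kyx [m _ /WK Kym]; apply: nK; exists m.
  rewrite (_ : _ * _ = (y * x^-1)^-1 * (y * (g m)^-1)).
    by apply: KM => //; exact: KV.
  by rewrite invgM invgK !mulgA mulgVK.
(* [F] contains all tails of the index set, so indices beyond any bound can be picked from its
   members. *)
have [F [FU ooF]] := ultraFilterLemma (_ : ProperFilter \oo).
have [Aop _] := Gli _ _ (ultrafilter_in_clopen_along g F FU) Bcl.
set A := ultrafilter_act _ _ in Aop.
have A1 : A 1.
  rewrite /A /ultrafilter_act /= (_ : [set _ | b in B] = B); last first.
    by apply/seteqP; split=> [_ [b Bb <-]|b Bb]; [|exists b => //];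
      rewrite invg1 mul1g.
  split=> //; apply: filterS filterT => n _; exists n => //=.
  by rewrite mulgV; have [_] := WP n.
suff : interior (\bigcap_n U n) 1 by rewrite U0.
(* For [s] in [A] and [K], some [n >= N] has [s * g n] in [W m g_m]. Both [s] and [W m] lie in [K],
   which forces [m = n], hence [s] is in [W n] and so in [U N]. *)
apply: (@filterS _ _ _ (A `&` K)).
  move=> s [[_ FA] Ks] N _.
  have : F [set n | (N <= n)%N] by apply: ooF; exists N.
  move=> /(filterI FA) /filter_ex[n [[b [m _ Wbm] sb] Nn]].
  have bE : b = s * g n by rewrite -sb mulVKg.
  have mn : n = m.
    apply: gK; rewrite (_ : _ * _ = s^-1 * (b * (g m)^-1)).
      by apply: KM; [exact: KV|exact: WK Wbm].
    by rewrite bE -mulgA mulKg.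
  have [_ _ _ WU] := WP n; apply: (WU _ Nn).
  by move: Wbm; rewrite -mn bE /= mulgK.
by apply: filterI; exact: open_nbhs_nbhs.
Qed.

End topological_groups.

(** * Case distinction on the three conditions *)

Theorem proposition2p8 (G : topologicalGroupType)
  (hausG : hausdorff_space G)
  (lcG : locally_compact [set: G])
  (tdG : totally_disconnected [set: G])
  (condG :
    (sigma_compact [set: G] /\ ~ compact_by_discrete [set: G])
    \/ (~ compact [set: G] /\
        ~ exists H : set G,
            [/\ subgroup H, open H, ~ compact H, sigma_compact H
              & compact_by_discrete H])
    \/ (~ compact [set: G] /\
        exists U : nat -> set G,
          (forall n, nbhs (1 : G) (U n)) /\
          interior (\bigcap_n U n) = set0)) :
  ~ left_introverted (@clopen G).
Proof.
have [K [Ksub Ko Kc]] := exists_compact_open_subgroup hausG lcG tdG.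
have Kcl : closed K by exact: compact_closed.
suff [nGc [U [Un U0]]] : ~ compact [set: G] /\ exists U : nat -> set G,
    (forall n, nbhs (1 : G) (U n)) /\ interior (\bigcap_n U n) = set0.
  have [g gK] := separated_sequence Ksub Kc nGc.
  exact: (thin_neighbourhoods_not_left_introverted hausG lcG tdG Ksub Ko gK Un U0).
have Gsub : subgroup [set: G] by [].
case: condG => [[Gsc nG]|[[nGc nH]|//]].
  split; last exact: thin_neighbourhoods Gsc nG Gsub Ksub Ko Kc Kcl _.
  (* A compact [G] is compact-by-discrete, with [G] itself as the compact open normal subgroup. *)
  move=> Gc; apply: nG; exists [set: G]; split=> //.
  exact: openT.
split=> //; have [g gK] := separated_sequence Ksub Kc nGc.
have [H [Hsub Hsc KH Hg]] := @sigma_compact_subgroup_with_sequence _ _ g Ksub Kc.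
(* If [H] were compact-by-discrete, it would be excluded by [nH]: it is open because it contains
   [K], and noncompact because it contains the sequence [g]. *)
apply: (thin_neighbourhoods Hsc _ Hsub Ksub Ko Kc Kcl KH) => Hcd.
apply: nH; exists H; split=> //.
  apply: (open_subgroup (x := 1) Hsub); apply: filterS KH _.
  by apply: open_nbhs_nbhs; split=> //; case: Ksub.
by move=> Hc; exact: (compact_no_separated_sequence Ksub Ko gK Hc Hg).
Qed.
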